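(* For all lists of integers $c_1,c_2$ with $\mathit{Wf}\ c_1$ and $\mathit{Wf}\ c_2$, and for all integers $\ell_1,\ell_2$: if $\ell_1\in c_1$, $\ell_2\in c_2$ and $\ell_1=\ell_2$, then $\ell_1\in c_1\bowtie c_2$ and $\mathit{count}(\ell_1, c_1\bowtie c_2)=1$.
   Context: Literals are integers and clauses are finite lists of integers. Lists are written $x::xs$ (cons) and $\mathit{nil}$ (empty); $\mathit{rev}$ reverses a list, $\mathit{app}$ concatenates two lists, $\mathit{abs}$ is the absolute value, $\in$ denotes list membership, and $\mathit{count}(\ell,c)$ is the number of occurrences of $\ell$ in the list $c$. The function $\mathit{auxunion}(c_1,c_2,acc)$ is defined recursively by: - if $c_1=\mathit{nil}$, return $\mathit{app}(\mathit{rev}\ acc,c_2)$; - else if $c_2=\mathit{nil}$, return $\mathit{app}(\mathit{rev}\ acc,c_1)$; - else, with $c_1=x::xs$ and $c_2=y::ys$: - if $\mathit{abs}\,x<\mathit{abs}\,y$, return $\mathit{auxunion}(xs,y::ys,x::acc)$; - else if $\mathit{abs}\,y<\mathit{abs}\,x$, return $\mathit{auxunion}(x::xs,ys,y::acc)$; - else if $x=y$, return $\mathit{auxunion}(xs,ys,x::acc)$; - else return $\mathit{auxunion}(xs,ys,x::y::acc)$. The function $\mathit{union}(c_1,c_2,acc)$ is defined recursively by: - if $c_1=\mathit{nil}$, return $\mathit{app}(\mathit{rev}\ acc,c_2)$; - else if $c_2=\mathit{nil}$, return $\mathit{app}(\mathit{rev}\ acc,c_1)$; - else, with $c_1=x::xs$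 and $c_2=y::ys$: - if $x+y=0$, return $\mathit{auxunion}(xs,ys,acc)$; - else if $\mathit{abs}\,x<\mathit{abs}\,y$, return $\mathit{union}(xs,y::ys,x::acc)$; - else if $\mathit{abs}\,y<\mathit{abs}\,x$, return $\mathit{union}(x::xs,ys,y::acc)$; - else return $\mathit{union}(xs,ys,x::acc)$. The resolution function is $c_1\bowtie c_2:=\mathit{union}(c_1,c_2,\mathit{nil})$. $\mathit{Wf}\ c$ means the conjunction of three conditions: - $\mathit{NoCompPair}\ c$: there is no literal $x\in c$ with $-x\in c$; - $\mathit{NoDup}\ c$: $c$ has no duplicate elements; - $\mathit{sorted}\ c$: $c$ is sorted in ascending order of absolute value. *)

(* Defs.v *)
(* Literals are integers [Z], clauses are [list Z]. *)
From Stdlib Require Import ZArith List Sorted.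
Import ListNotations.
Open Scope Z_scope.

(* The recursive calls drop the head of [c1], of [c2], or of both, so the
   functions are written as nested fixpoints; the lemmas [auxunion_eq] and
   [union_eq] give the flat recursion equations. *)
Fixpoint auxunion (c1 : list Z) : list Z -> list Z -> list Z :=
  fix auxunion_c1 (c2 acc : list Z) {struct c2} : list Z :=
    match c1, c2 with
    | [], _ => rev acc ++ c2
    | _, [] => rev acc ++ c1
    | x :: xs, y :: ys =>
        if Z.abs x <? Z.abs y then auxunion xs c2 (x :: acc)
        else if Z.abs y <? Z.abs x then auxunion_c1 ys (y :: acc)
        else if x =? y then auxunion xs ys (x :: acc)
        else auxunion xs ys (x :: y :: acc)
    end.

Fixpoint union (c1 : list Z) : list Z -> list Z -> list Z :=
  fix union_c1 (c2 acc : list Z) {struct c2} : list Z :=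
    match c1, c2 with
    | [], _ => rev acc ++ c2
    | _, [] => rev acc ++ c1
    | x :: xs, y :: ys =>
        if x + y =? 0 then auxunion xs ys acc
        else if Z.abs x <? Z.abs y then union xs c2 (x :: acc)
        else if Z.abs y <? Z.abs x then union_c1 ys (y :: acc)
        else union xs ys (x :: acc)
    end.

Lemma auxunion_eq (c1 c2 acc : list Z) :
  auxunion c1 c2 acc =
    match c1, c2 with
    | [], _ => rev acc ++ c2
    | _, [] => rev acc ++ c1
    | x :: xs, y :: ys =>
        if Z.abs x <? Z.abs y then auxunion xs (y :: ys) (x :: acc)
        else if Z.abs y <? Z.abs x then auxunion (x :: xs) ys (y :: acc)
        else if x =? y then auxunion xs ys (x :: acc)
        else auxunion xs ys (x :: y :: acc)
    end.
Proof. destruct c1, c2; reflexivity. Qed.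

Lemma union_eq (c1 c2 acc : list Z) :
  union c1 c2 acc =
    match c1, c2 with
    | [], _ => rev acc ++ c2
    | _, [] => rev acc ++ c1
    | x :: xs, y :: ys =>
        if x + y =? 0 then auxunion xs ys acc
        else if Z.abs x <? Z.abs y then union xs (y :: ys) (x :: acc)
        else if Z.abs y <? Z.abs x then union (x :: xs) ys (y :: acc)
        else union xs ys (x :: acc)
    end.
Proof. destruct c1, c2; reflexivity. Qed.

Definition resolution (c1 c2 : list Z) : list Z := union c1 c2 [].

Infix "⋈" := resolution (at level 50, left associativity) : Z_scope.

Definition NoCompPair (c : list Z) : Prop := ~ exists x, In x c /\ In (- x) c.

(* Non-strict: strictness follows from the other two conditions of [Wf]. *)
Definition sorted (c : list Z) : Prop :=
  Sorted (fun x y => Z.abs x <= Z.abs y) c.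

Definition Wf (c : list Z) : Prop := NoCompPair c /\ NoDup c /\ sorted c.

Definition count (l : Z) (c : list Z) : nat := count_occ Z.eq_dec c l.

(* Main.v *)
(* On clauses with strictly increasing absolute values, [auxunion] merges its
   arguments as multisets: the multiplicity of a literal in the result is the
   maximum of its multiplicities in the arguments. [union] does the same for a
   literal whose opposite is in neither clause, since the one pair that it
   cancels cannot involve that literal. A well-formed clause has strictly
   increasing absolute values, and contains a shared literal exactly once and
   its opposite never. *)
Require Import Defs.
From Stdlib Require Import ZArith List.
From Stdlib Require Import Sorted Lia.
Import ListNotations.
Open Scope Z_scope.

Definition abs_increasing (c : list Z) : Prop :=
  StronglySorted (fun x y => Z.abs x < Z.abs y) c.

(** Integers of equal absolute value are equal or opposite; [NoDup] excludes the first case and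
    [NoCompPair] the second. *)
Lemma Wf_abs_increasing (c : list Z) : Wf c -> abs_increasing c.
Proof.
  intros (Hcomp & Hnodup & Hsorted).
  apply Sorted_StronglySorted in Hsorted; [| intros x y z; lia].
  induction Hsorted as [| x xs Hxs IH Hx]; [constructor |].
  apply NoDup_cons_iff in Hnodup as [Hnotin Hnodup].
  constructor.
  - apply IH; [| exact Hnodup].
    intros (y & Hy & Hy'); apply Hcomp; exists y; simpl; auto.
  - rewrite Forall_forall in *; intros y Hy.
    specialize (Hx y Hy).
    assert (x <> y) by congruence.
    assert (y <> - x)
      by (intros ->; apply Hcomp; exists x; simpl; auto).
    lia.
Qed.

Lemma count_cons (l x : Z) (c : list Z) :
  count l (x :: c) = ((if Z.eq_dec x l then 1 else 0) + count l c)%nat.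
Proof. unfold count; simpl; destruct (Z.eq_dec x l); reflexivity. Qed.

Lemma count_rev_app (l : Z) (acc c : list Z) :
  count l (rev acc ++ c) = (count l acc + count l c)%nat.
Proof. unfold count; rewrite count_occ_app, count_occ_rev; reflexivity. Qed.

Lemma count_small (l x : Z) (xs : list Z) :
  abs_increasing (x :: xs) -> Z.abs l <= Z.abs x -> count l xs = 0%nat.
Proof.
  intros H Hl; apply StronglySorted_inv in H as [_ H].
  apply count_occ_not_In; intros Hin.
  rewrite Forall_forall in H; specialize (H l Hin); lia.
Qed.

Lemma abs_increasing_tail (x : Z) (xs : list Z) :
  abs_increasing (x :: xs) -> abs_increasing xs.
Proof. intros H; apply (StronglySorted_inv H). Qed.

(** Each step outputs heads of least absolute value. If [l] is among them, [count_small] rules it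
    out of both tails, so this one output accounts for the whole maximum. *)
Lemma count_auxunion (l : Z) (c1 c2 acc : list Z) :
  abs_increasing c1 -> abs_increasing c2 ->
  count l (auxunion c1 c2 acc) =
    (count l acc + Nat.max (count l c1) (count l c2))%nat.
Proof.
  revert c2 acc; induction c1 as [| x xs IH1]; intros c2 acc H1.
  { intros _; rewrite auxunion_eq; apply count_rev_app. }
  (* The inner induction keeps [x :: xs] fixed, like the nested fixpoint: [IH2] serves the branch
     that drops only [y], [IH1] those that drop [x]. *)
  revert acc; induction c2 as [| y ys IH2]; intros acc H2; rewrite auxunion_eq.
  { rewrite count_rev_app, Nat.max_0_r; reflexivity. }
  pose proof (abs_increasing_tail _ _ H1) as H1'.
  pose proof (abs_increasing_tail _ _ H2) as H2'.
  pose proof (count_small l _ _ H1) as Z1.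
  pose proof (count_small l _ _ H2) as Z2.
  destruct (Z.ltb_spec (Z.abs x) (Z.abs y));
    [| destruct (Z.ltb_spec (Z.abs y) (Z.abs x));
       [| destruct (Z.eqb_spec x y)]];
    rewrite ?IH1, ?IH2, !count_cons by assumption;
    destruct (Z.eq_dec x l), (Z.eq_dec y l); lia.
Qed.

Lemma count_union (l : Z) (c1 c2 acc : list Z) :
  abs_increasing c1 -> abs_increasing c2 -> ~ In (- l) c1 -> ~ In (- l) c2 ->
  count l (union c1 c2 acc) =
    (count l acc + Nat.max (count l c1) (count l c2))%nat.
Proof.
  revert c2 acc; induction c1 as [| x xs IH1]; intros c2 acc H1.
  { intros _ _ _; rewrite union_eq; apply count_rev_app. }
  revert acc; induction c2 as [| y ys IH2]; intros acc H2 N1 N2;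
    rewrite union_eq.
  { rewrite count_rev_app, Nat.max_0_r; reflexivity. }
  pose proof (abs_increasing_tail _ _ H1) as H1'.
  pose proof (abs_increasing_tail _ _ H2) as H2'.
  pose proof (count_small l _ _ H1) as Z1.
  pose proof (count_small l _ _ H2) as Z2.
  pose proof (fun H => N1 (in_cons x _ _ H)) as N1'.
  pose proof (fun H => N2 (in_cons y _ _ H)) as N2'.
  assert (x <> - l) by (intros ->; apply N1, in_eq).
  assert (y <> - l) by (intros ->; apply N2, in_eq).
  destruct (Z.eqb_spec (x + y) 0).
  (* If one cancelled head were [l], the other would be [- l]; so the cancellation leaves the count
     of [l] unchanged. *)
  { rewrite count_auxunion, !count_cons by assumption.
    destruct (Z.eq_dec x l), (Z.eq_dec y l); lia. }
  (* In the last branch the absolute values agree and [x + y <> 0], so [x = y] and pushing [x] alone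
     suffices. *)
  destruct (Z.ltb_spec (Z.abs x) (Z.abs y));
    [| destruct (Z.ltb_spec (Z.abs y) (Z.abs x))];
    rewrite ?IH1, ?IH2, !count_cons by assumption;
    destruct (Z.eq_dec x l), (Z.eq_dec y l); lia.
Qed.

Lemma Wf_count (l : Z) (c : list Z) : Wf c -> In l c -> count l c = 1%nat.
Proof.
  intros (_ & Hnodup & _).
  apply (proj1 (NoDup_count_occ' Z.eq_dec c) Hnodup).
Qed.

Lemma Wf_opp_notin (l : Z) (c : list Z) : Wf c -> In l c -> ~ In (- l) c.
Proof. intros (Hcomp & _) Hin Hopp; apply Hcomp; exists l; auto. Qed.

Theorem theorem4 (c1 c2 : list Z) (wf1 : Wf c1) (wf2 : Wf c2) (l1 l2 : Z)
  (h1 : In l1 c1) (h2 : In l2 c2) (h12 : l1 = l2) :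
  In l1 (c1 ⋈ c2) /\ count l1 (c1 ⋈ c2) = 1%nat.
Proof.
  subst l2.
  assert (Hcount : count l1 (c1 ⋈ c2) = 1%nat).
  { unfold resolution.
    (* The accumulator starts empty, so the count becomes [0 + max 1 1]. *)
    rewrite count_union, (Wf_count l1 c1), (Wf_count l1 c2)
      by auto using Wf_abs_increasing, Wf_opp_notin.
    reflexivity. }
  split; [| exact Hcount].
  apply (count_occ_In Z.eq_dec); fold (count l1 (c1 ⋈ c2)); lia.
Qed.
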